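(* Let $\mathcal{H}=\mathcal{H}(X)$ be a reproducing kernel Hilbert space on a nonempty set $X$, let $A\in\mathcal{B}(\mathcal{H})^+$, and let $M,N\in\mathcal{B}_A(\mathcal{H})$ have closed ranges, with the pairs $(A,\mathcal{R}(M))$, $(A,\mathcal{N}(M))$, $(A,\mathcal{R}(N))$ and $(A,\mathcal{N}(N))$ compatible. Let $M^{\dagger_A}$, $N^{\dagger_A}$ be $A$-generalized inverses of $M$ and $N$. Then $$\|M+N\|_{\mathbf{ber}_A}^2\leq\mathbf{ber}_A(M^{\#_A}M+iN^{\#_A}N)\,\mathbf{ber}_A(MM^{\dagger_A}+iNN^{\dagger_A})+\frac12\,\mathbf{ber}_A(M^{\#_A}M+N^{\#_A}N)+\mathbf{ber}_A(N^{\#_A}M).$$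
   Context: A reproducing kernel Hilbert space $\mathcal{H}(X)$ is a complex Hilbert space of complex-valued functions on $X$ on which every evaluation $\phi\mapsto\phi(x)$, $x\in X$, is continuous; $k_x\in\mathcal{H}$ is the element with $\phi(x)=\langle\phi,k_x\rangle$ for all $\phi\in\mathcal{H}$. $\mathcal{B}(\mathcal{H})$ is the algebra of bounded linear operators on $\mathcal{H}$, $\mathcal{B}(\mathcal{H})^+=\{T\in\mathcal{B}(\mathcal{H}):\langle Tu,u\rangle\ge0\ \forall u\in\mathcal{H}\}$; $\mathcal{R}(T)$, $\mathcal{N}(T)$ denote range and null space; $i$ is the imaginary unit. For $A\in\mathcal{B}(\mathcal{H})^+$: $\langle u,v\rangle_A=\langle Au,v\rangle$ and $\|u\|_A=\langle u,u\rangle_A^{1/2}$. $\mathcal{B}_A(\mathcal{H})=\{T\in\mathcal{B}(\mathcal{H}):\mathcal{R}(T^*A)\subseteq\mathcal{R}(A)\}$. For $T\in\mathcal{B}_A(\mathcal{H})$, $T^{\#_A}$ is the unique $Y\in\mathcal{B}(\mathcal{H})$ with $AY=T^*A$ and $\mathcal{R}(Y)\subseteq\overline{\mathcal{R}(A)}$; in particular $\langle Tu,v\rangle_A=\langle u,T^{\#_A}v\rangle_A$. For a closed subspace $V$, the pair $(A,V)$ is compatible if there is $Q\in\mathcal{B}(\mathcal{H})$ with $Q^2=Q$, $\mathcal{R}(Q)=V$, $AQ=Q^*A$. An $A$-generalized inverse of a closed-range operator $T$ is an operator $T^{\dagger_A}\in\mathcal{B}(\mathcal{H})$ with $TT^{\dagger_A}T=T$,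 $T^{\dagger_A}TT^{\dagger_A}=T^{\dagger_A}$, $ATT^{\dagger_A}=(TT^{\dagger_A})^*A$, $AT^{\dagger_A}T=(T^{\dagger_A}T)^*A$. (Known: it exists if and only if $(A,\mathcal{R}(T))$ and $(A,\mathcal{N}(T))$ are compatible.) The $A$-normalized reproducing kernel is $\hat k_x'=k_x/\|k_x\|_A$, for those $x\in X$ with $\|k_x\|_A\neq0$. The $A$-Berezin number is $\mathbf{ber}_A(T)=\sup_{x}|\langle T\hat k_x',\hat k_x'\rangle_A|$ and the $A$-Berezin norm is $\|T\|_{\mathbf{ber}_A}=\sup_{x,y}|\langle T\hat k_x',\hat k_y'\rangle_A|$, the suprema being over points of $X$ with $\|k_x\|_A\ne0$, $\|k_y\|_A\neq0$. *)

(* Defs.v *)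
From HB Require Import structures.
From mathcomp Require Import all_boot all_order all_algebra.
From mathcomp Require Import sesquilinear complex.
From mathcomp Require Import all_classical all_reals all_analysis.

Set Implicit Arguments.
Unset Strict Implicit.
Unset Printing Implicit Defensive.

Import Order.TTheory GRing.Theory Num.Theory.
Import numFieldNormedType.Exports.

Local Open Scope classical_set_scope.
Local Open Scope ring_scope.
Local Open Scope complex_scope.

(* Complex Hilbert space of complex-valued functions on X with continuous
   evaluations: [rk_eval] is the (linear, injective) inclusion of the space in
   X -> R[i]. The inner product is linear in its first argument and
   conjugate-linear in the second one. *)
Record rkhs (R : realType) (X : Type) := RKHS {
  rk_space :> completeNormedModType R[i] ;
  rk_dot : {dot rk_space for Num.conj} ;
  rk_normE : forall u : rk_space, `|u| = sqrtC (rk_dot u u) ;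
  rk_eval : {linear rk_space -> (X -> R[i])} ;
  rk_eval_inj : injective rk_eval ;
  rk_eval_continuous : forall x : X,
    continuous (fun u : rk_space => rk_eval u x : R[i]^o) }.

Arguments rk_dot {R X} r.
Arguments rk_eval {R X} r.

Section Operators.
Context {R : realType} {X : Type} {H : rkhs R X}.
Implicit Types (A T S Q Y : {linear H -> H}) (k : X -> H) (u v : H).

Local Notation "''[' u , v ]" := (rk_dot H u v).

Definition reproducing_kernel k :=
  forall (f : H) (x : X), rk_eval H f x = '[f, k x].

(* Elements of B(H) are the T : {linear H -> H} with [continuous T]. *)

(* S = T^*; by the Riesz representation theorem every bounded T has exactly one
   bounded adjoint, so "there is an S with [adjoint T S] and P S" below
   expresses P T^*. *)
Definition adjoint T S := continuous S /\ forall u v, '[T u, v] = '[u, S v].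

Definition positive_op A := continuous A /\ forall u, 0 <= '[A u, u].

Definition in_BA A T := continuous T /\
  exists2 S, adjoint T S & range (S \o A) `<=` range A.

(* A T = T^* A *)
Definition A_selfadjoint A T :=
  exists2 S, adjoint T S & forall u, A (T u) = S (A u).

(* Y = T^{#_A} *)
Definition A_adjoint A T Y :=
  [/\ continuous Y,
      exists2 S, adjoint T S & forall u, A (Y u) = S (A u)
    & range Y `<=` closure (range A)].

Definition null_space T : set H := [set u | T u = 0].

Definition compatible A (V : set H) :=
  exists Q, [/\ continuous Q, forall u, Q (Q u) = Q u, range Q = V
    & A_selfadjoint A Q].

(* Y = T^{dagger_A} *)
Definition A_generalized_inverse A T Y :=
  [/\ continuous Y,
      forall u, T (Y (T u)) = T u,
      forall u, Y (T (Y u)) = Y u,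
      A_selfadjoint A (T \o Y)
    & A_selfadjoint A (Y \o T)].

Definition A_dot A u v : R[i] := '[A u, v].
Definition A_norm A u : R[i] := sqrtC (A_dot A u u).
Definition A_kernel A k x : H := (A_norm A (k x))^-1 *: k x.
Definition A_points A k : set X := [set x | A_norm A (k x) != 0].

(* [Normc.normc : R[i] -> R] is the modulus. [sup] is the supremum in R, with
   value 0 on the empty set (the case where no k_x has nonzero A-seminorm). *)
Definition ber A k (T : H -> H) : R :=
  sup [set r | exists2 x, A_points A k x &
    r = Normc.normc (A_dot A (T (A_kernel A k x)) (A_kernel A k x))].

Definition ber_norm A k (T : H -> H) : R :=
  sup [set r | exists x y, [/\ A_points A k x, A_points A k y &
    r = Normc.normc (A_dot A (T (A_kernel A k x)) (A_kernel A k y))]].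

End Operators.

(* Main.v *)
Require Import Defs.
From mathcomp Require Import all_boot all_order all_algebra.
From mathcomp Require Import sesquilinear complex ring lra.
From mathcomp Require Import all_classical all_reals all_analysis.

Set Implicit Arguments.
Unset Strict Implicit.
Unset Printing Implicit Defensive.

Import Order.TTheory GRing.Theory Num.Theory.
Import numFieldNormedType.Exports.

Local Open Scope classical_set_scope.
Local Open Scope ring_scope.

(** Write [<u, v>] for the semi-inner product [A_dot A u v] and [|u|] for its
    seminorm. Two things have to be shown: an inequality between values at
    points, and the finiteness of the suprema on the right-hand side.

    The inequality at points. Let [a] and [b] be normalized kernels, so that
    [|a| = |b| = 1]. Squaring the triangle inequality bounds
    [|<M a + N a, b>|^2] by the diagonal terms [|<M a, b>|^2 + |<N a, b>|^2]
    plus the cross term [2 |<M a, b>| |<N a, b>|].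
    The operator [E = M Md] is an idempotent, symmetric for [<.,.>], which
    fixes every vector in the range of [M]. Hence [<M a, b> = <M a, E b>], and
    Cauchy-Schwarz gives [|<M a, b>|^2 <= |M a|^2 |E b|^2 = <Ms M a, a> <E b, b>]; the same
    holds for [N] and [F = N Nd]. A second use of Cauchy-Schwarz, in the real
    plane, bounds the sum of the two products by
    [|<Ms M a + i Ns N a, a>| |<E b + i F b, b>|], because a complex number
    [p + i q] with real [p] and [q] has modulus [sqrt (p^2 + q^2)].
    The cross term is bounded by [|M a| |N a| + |<M a, N a>|] by Buzano's
    inequality, and then by the arithmetic-geometric mean inequality and
    [<M a, N a> = <Ns M a, a>]. This is [pointwise_inequality].

    Finiteness. A supremum of an unbounded set is 0 by convention, so the step
    from values to suprema needs every operator on the right to be bounded for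
    the seminorm. Idempotents symmetric for [<.,.>] are contractions by
    Cauchy-Schwarz. For [M] the argument is the one by which Lax bounds
    symmetrizable operators: put [P = Ms M]; by Cauchy-Schwarz the numbers
    [|P^n u|^2] form a log-convex sequence, and by continuity of [A], [M] and
    [Ms] in the norm of the Hilbert space they grow at most geometrically, at
    a rate independent of [u]. So that rate bounds the first ratio
    [|P u|^2 / |u|^2]. This is [semi_bounded_of_geometric_growth]. *)

Local Notation modulus := Normc.normc.

(** * Real numbers *)

Section RealNumbers.
Context {R : realType}.

(** Log-convexity makes the successive ratios nondecreasing, so the first ratio
    is at most the rate of any geometric bound: were it larger than [c], the
    sequence would outgrow [K * c ^+ n]. *)
Lemma log_convex_ratio_bound (a : nat -> R) (c K : R) :
  0 < c -> (forall n, 0 <= a n) ->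
  (forall n, a n.+1 ^+ 2 <= a n * a n.+2) ->
  (forall n, a n <= K * c ^+ n) ->
  a 1 <= c * a 0.
Proof.
move=> c0 a0 aconv aK; rewrite leNgt; apply/negP => a1.
have a1gt0 : 0 < a 1 by apply: le_lt_trans a1; rewrite mulr_ge0 ?a0 // ltW.
have a0gt0 : 0 < a 0.
  rewrite lt_neqAle a0 andbT; apply/negP => /eqP a00.
  by have := aconv 0; rewrite -a00 mul0r leNgt exprn_gt0.
pose r := a 1 / a 0.
have rc : 1 < r / c by rewrite ltr_pdivlMr // mul1r ltr_pdivlMr.
have r0 : 0 < r by rewrite divr_gt0.
have step n : 0 < a n /\ r * a n <= a n.+1.
  elim: n => [|n [an IHn]]; first by rewrite /r mulrVK ?unitfE ?gt_eqF.
  have an1 : 0 < a n.+1 by apply: lt_le_trans IHn; rewrite mulr_gt0.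
  split=> //; rewrite -(ler_pM2l an) (le_trans _ (aconv n)) //.
  by rewrite expr2 mulrA [a n * r]mulrC ler_wpM2r // ltW.
have geom n : r ^+ n * a 0 <= a n.
  elim: n => [|n IHn]; first by rewrite mul1r.
  by rewrite exprS -mulrA (le_trans _ (step n).2) // ler_wpM2l // ltW.
have bounded n : (r / c) ^+ n <= K / a 0.
  rewrite ler_pdivlMr // expr_div_n mulrAC ler_pdivrMr ?exprn_gt0 //.
  exact: le_trans (geom n) (aK n).
(* Bernoulli's inequality: the powers of a ratio above 1 are unbounded. *)
have bernoulli n : n%:R * (r / c - 1) <= (r / c) ^+ n.
  suff: 1 + n%:R * (r / c - 1) <= (r / c) ^+ n by apply: le_trans; rewrite lerDr.
  elim: n => [|n IHn]; first by rewrite mul0r addr0 expr0.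
  rewrite exprS -natr1.
  have := ler_wpM2l (ltW (lt_trans ltr01 rc)) IHn; apply: le_trans.
  have n0 : 0 <= n%:R :> R by rewrite ler0n.
  by have := mulr_ge0 n0 (sqr_ge0 (r / c - 1)); move: (r / c) => y; lra.
have s0 : 0 < r / c - 1 by rewrite subr_gt0.
have [n] : exists n : nat, K / a 0 / (r / c - 1) < n%:R.
  exists (Num.truncn (K / a 0 / (r / c - 1))).+1; exact: truncnS_gt.
rewrite ltr_pdivrMr // ltNge => /negP; apply.
exact: le_trans (bernoulli n) (bounded n).
Qed.

(** The Cauchy-Schwarz inequality for the vectors [(p1, p2)] and [(q1, q2)] of
    the plane. *)
Lemma sqr_sum_le_products (m n p1 q1 p2 q2 : R) :
  0 <= p1 -> 0 <= q1 -> 0 <= p2 -> 0 <= q2 ->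
  m ^+ 2 <= p1 * q1 -> n ^+ 2 <= p2 * q2 ->
  m ^+ 2 + n ^+ 2 <= Num.sqrt (p1 ^+ 2 + p2 ^+ 2) * Num.sqrt (q1 ^+ 2 + q2 ^+ 2).
Proof.
move=> p1_ge0 q1_ge0 p2_ge0 q2_ge0 hm hn.
apply: (le_trans (lerD hm hn)).
rewrite -sqrtrM ?addr_ge0 ?sqr_ge0 //.
rewrite -[leLHS]ger0_norm ?addr_ge0 ?mulr_ge0 // -sqrtr_sqr ler_wsqrtr //.
have := sqr_ge0 (p1 * q2 - p2 * q1); nra.
Qed.

(** For an empty or unbounded set this holds because its supremum is 0. *)
Lemma nonneg_sup_ge0 (E : set R) : (forall r, E r -> 0 <= r) -> 0 <= sup E.
Proof.
move=> E0; have [[[r Er] ubE]|/sup_out ->//] := pselect (has_sup E).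
exact: le_trans (E0 r Er) (ub_le_sup ubE Er).
Qed.

(** Nonnegativity of [b] accounts for the empty set, whose supremum is 0. *)
Lemma sup_le_nonneg_bound (E : set R) (b : R) :
  0 <= b -> (forall r, E r -> r <= b) -> sup E <= b.
Proof.
move=> b0 Eb; have [->|/set0P E0] := eqVneq E set0; first by rewrite sup0.
exact: ge_sup.
Qed.

End RealNumbers.

(** * Modulus of complex numbers *)

Section Modulus.
Context {R : realType}.
Implicit Types (z w : R[i]) (a b : R).

Lemma modulus_ge0 z : 0 <= modulus z.
Proof. by case: z => a b; exact: sqrtr_ge0. Qed.

Lemma modulus_add z w : modulus (z + w) <= modulus z + modulus w.
Proof. exact: le_normcD. Qed.

Lemma modulus_conj z : modulus (conjc z) = modulus z.
Proof. by case: z => a b /=; rewrite sqrrN. Qed.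

Lemma modulus_opp z : modulus (- z) = modulus z.
Proof. exact: normcN. Qed.

Lemma modulus_real a : 0 <= a -> modulus (a%:C)%C = a.
Proof. by move=> a0 /=; rewrite expr0n addr0 sqrtr_sqr ger0_norm. Qed.

Lemma modulus_combination a b :
  modulus ((a%:C)%C + 'i%C * (b%:C)%C) = Num.sqrt (a ^+ 2 + b ^+ 2).
Proof. by rewrite /=; congr Num.sqrt; ring. Qed.

Lemma mul_conj_modulus z : z * conjc z = ((modulus z ^+ 2)%:C)%C.
Proof.
case: z => a b; rewrite /= sqr_sqrtr ?addr_ge0 ?sqr_ge0 //.
by apply/eqP; rewrite eq_complex /=; apply/andP; split; apply/eqP; ring.
Qed.

End Modulus.

(** * Semi-inner products *)

Record semi_inner {R : realType} {V : lmodType R[i]} (g : V -> V -> R[i]) :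
    Prop := SemiInner {
  semi_innerP : forall a u v w, g (a *: u + v) w = a * g u w + g v w ;
  semi_innerC : forall u v, g u v = conjc (g v u) ;
  semi_inner_ge0 : forall u, 0 <= g u u }.

Section SemiInnerTheory.
Context {R : realType} {V : lmodType R[i]} (g : V -> V -> R[i]).
Context (gP : semi_inner g).
Implicit Types (u v w e : V) (a : R[i]) (T S P E : V -> V).

Definition sqnorm u : R := complex.Re (g u u).

Lemma semi_innerDl u v w : g (u + v) w = g u w + g v w.
Proof. by rewrite -{1}(scale1r u) (semi_innerP gP) mul1r. Qed.

Lemma semi_inner0l w : g 0 w = 0.
Proof. by apply: (addrI (g 0 w)); rewrite -semi_innerDl !addr0. Qed.

Lemma semi_innerZl a u w : g (a *: u) w = a * g u w.
Proof. by rewrite -[a *: u]addr0 (semi_innerP gP) semi_inner0l addr0. Qed.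

Lemma semi_innerDr u v w : g u (v + w) = g u v + g u w.
Proof. by rewrite (semi_innerC gP) semi_innerDl rmorphD /= -!(semi_innerC gP). Qed.

Lemma semi_innerZr a u w : g u (a *: w) = conjc a * g u w.
Proof. by rewrite (semi_innerC gP) semi_innerZl rmorphM /= -(semi_innerC gP). Qed.

Lemma modulus_sym u v : modulus (g u v) = modulus (g v u).
Proof. by rewrite (semi_innerC gP) modulus_conj. Qed.

Lemma semi_inner_self u : g u u = ((sqnorm u)%:C)%C.
Proof. by rewrite RRe_real // ger0_real // (semi_inner_ge0 gP). Qed.

Lemma sqnorm_ge0 u : 0 <= sqnorm u.
Proof. by have := semi_inner_ge0 gP u; rewrite semi_inner_self ler0c. Qed.

Lemma modulus_self u : modulus (g u u) = sqnorm u.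
Proof. by rewrite semi_inner_self modulus_real // sqnorm_ge0. Qed.

Lemma sqnormZ a u : sqnorm (a *: u) = modulus a ^+ 2 * sqnorm u.
Proof.
apply: complexI; rewrite -semi_inner_self semi_innerZl semi_innerZr semi_inner_self.
by rewrite mulrA mul_conj_modulus -rmorphM.
Qed.

Lemma sqnormD_scale (a : R[i]) u v :
  sqnorm (u + a *: v)
  = sqnorm u + 2 * complex.Re (conjc a * g u v) + modulus a ^+ 2 * sqnorm v.
Proof.
rewrite {1}/sqnorm semi_innerDl !semi_innerDr.
rewrite (_ : g (a *: v) u = conjc (g u (a *: v))); last first.
  exact: semi_innerC.
rewrite !raddfD /= -!/(sqnorm _) sqnormZ semi_innerZr.
by case: (_ * g u v) => x y /=; ring.
Qed.

(** Along the real line through [u] directed by [g u v *: v], the squared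
    seminorm is a real quadratic polynomial in [t]: the phase of [g u v] is
    absorbed in the direction. *)
Lemma sqnormD_real_scale (t : R) u v :
  sqnorm (u + ((t%:C)%C * g u v) *: v)
  = sqnorm u + 2 * t * modulus (g u v) ^+ 2
    + t ^+ 2 * modulus (g u v) ^+ 2 * sqnorm v.
Proof.
rewrite sqnormD_scale.
have -> : modulus ((t%:C)%C * g u v) ^+ 2 = t ^+ 2 * modulus (g u v) ^+ 2.
  by rewrite Normc.normcM exprMn /= expr0n addr0 sqr_sqrtr // sqr_ge0.
have -> : conjc ((t%:C)%C * g u v) * g u v = ((t * modulus (g u v) ^+ 2)%:C)%C.
  rewrite rmorphM [RHS]rmorphM /= -mul_conj_modulus; case: (g u v) => x y.
  by apply/eqP; rewrite eq_complex /=; apply/andP; split; apply/eqP; ring.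
by rewrite /= mulrA.
Qed.

(** The nonnegative polynomial of [sqnormD_real_scale] is evaluated at its
    minimum [- 1 / sqnorm v]. If [sqnorm v = 0] the polynomial is affine, and it
    stays nonnegative only when [g u v = 0]. *)
Lemma semi_cauchy_schwarz u v : modulus (g u v) ^+ 2 <= sqnorm u * sqnorm v.
Proof.
have Q t := sqnorm_ge0 (u + ((t%:C)%C * g u v) *: v).
have {}Q t : 0 <= sqnorm u + 2 * t * modulus (g u v) ^+ 2
    + t ^+ 2 * modulus (g u v) ^+ 2 * sqnorm v.
  by rewrite -sqnormD_real_scale; exact: Q.
have B0 : 0 <= modulus (g u v) ^+ 2 by rewrite sqr_ge0.
move: (modulus _ ^+ 2) B0 Q => B B0 Q.
have := sqnorm_ge0 u; have := sqnorm_ge0 v.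
rewrite le_eqVlt => /predU1P[v0 u0|v0 u0].
  rewrite -v0 mulr0 leNgt; apply/negP => Bgt0.
  (* At this [t] the affine polynomial takes the value [- sqnorm u - 2]. *)
  have := Q (- (sqnorm u + 1) / B); rewrite -v0 mulr0 addr0.
  rewrite mulrA mulrVK ?unitfE ?gt_eqF //.
  lra.
have := Q (- (sqnorm v)^-1); set c := sqnorm v in v0 *.
rewrite -ler_pdivrMr // => h.
suff E : - c^-1 * 2 * B + c^-1 ^+ 2 * B * c = - (B / c).
  move: h; rewrite sqrrN [2 * - _]mulrC -addrA E; lra.
by field; rewrite gt_eqF.
Qed.

Lemma modulus_le_sqrt u v :
  modulus (g u v) <= Num.sqrt (sqnorm u) * Num.sqrt (sqnorm v).
Proof.
rewrite -sqrtrM ?sqnorm_ge0 // -[leLHS]ger0_norm ?modulus_ge0 // -sqrtr_sqr.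
exact/ler_wsqrtr/semi_cauchy_schwarz.
Qed.

(** The reflection [2 <u, e> e - u] in the line of the unit vector [e] has the
    same seminorm as [u]. Cauchy-Schwarz for the reflected vector and [v] bounds
    the modulus of [2 <u, e> <e, v> - <u, v>]. *)
Lemma semi_buzano e u v : sqnorm e = 1 ->
  2 * (modulus (g u e) * modulus (g e v))
  <= Num.sqrt (sqnorm u) * Num.sqrt (sqnorm v) + modulus (g u v).
Proof.
move=> e1.
(* [u + r *: e] is the opposite of the reflected vector. *)
set r := (- (2 * g u e)).
have r_norm : sqnorm (u + r *: e) = sqnorm u.
  have -> : r = ((- 2 : R)%:C)%C * g u e by rewrite rmorphN rmorph_nat mulNr.
  rewrite sqnormD_real_scale e1; ring.
have := modulus_le_sqrt (u + r *: e) v; rewrite r_norm => h.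
rewrite -!Normc.normcM.
have -> : 2 * modulus (g u e * g e v) = modulus (g (u + r *: e) v - g u v).
  have two : modulus (2 : R[i]) = 2.
    by rewrite -(rmorph_nat (real_complex R)) modulus_real.
  rewrite semi_innerDl semi_innerZl [X in _ = modulus X]addrC addKr /r mulNr modulus_opp.
  by rewrite -mulrA [RHS]Normc.normcM two.
apply: le_trans (modulus_add _ _) _; rewrite modulus_opp lerD2r //.
Qed.

End SemiInnerTheory.

(** * Operators bounded for a seminorm *)

Section BoundedOperators.
Context {R : realType} {V : lmodType R[i]} (g : V -> V -> R[i]).
Context (gP : semi_inner g).
Implicit Types (u v w e : V) (T S P E : V -> V).

Local Notation sq := (sqnorm g).

(** The bound is on squared seminorms, so [c] bounds the square of an
    operator norm. *)
Definition semi_bounded T := exists2 c : R, 0 <= c & forall u, sq (T u) <= c * sq u.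

Definition semi_adjoint T S := forall u v, g (T u) v = g u (S v).

Lemma semi_adjoint_sym T S : semi_adjoint T S -> semi_adjoint S T.
Proof. by move=> TS u v; rewrite (semi_innerC gP) -TS -(semi_innerC gP). Qed.

Lemma sqnorm_adjoint T S u : semi_adjoint T S -> g (S (T u)) u = ((sq (T u))%:C)%C.
Proof. by move=> /semi_adjoint_sym ->; rewrite (semi_inner_self gP). Qed.

Lemma semi_bounded_comp T S :
  semi_bounded T -> semi_bounded S -> semi_bounded (fun u => T (S u)).
Proof.
move=> [c c0 Tc] [d d0 Sd]; exists (c * d) => [|u]; first exact: mulr_ge0.
by rewrite (le_trans (Tc _)) // -mulrA ler_wpM2l.
Qed.

Lemma semi_bounded_scale a T :
  semi_bounded T -> semi_bounded (fun u => a *: T u).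
Proof.
move=> [c c0 Tc]; exists (modulus a ^+ 2 * c) => [|u].
  by rewrite mulr_ge0 ?sqr_ge0.
by rewrite (sqnormZ gP) -[leRHS]mulrA ler_wpM2l ?sqr_ge0.
Qed.

Lemma semi_bounded_add T S :
  semi_bounded T -> semi_bounded S -> semi_bounded (fun u => T u + S u).
Proof.
move=> [c c0 Tc] [d d0 Sd]; exists (2 * (c + d)) => [|u].
  by rewrite mulr_ge0 ?addr_ge0.
(* Half of the parallelogram identity: [sq (x - y)] is dropped. *)
have parallelogram x y : sq (x + y) <= 2 * (sq x + sq y).
  have := sqnorm_ge0 gP (x + (-1) *: y).
  rewrite -[in sq (x + y)](scale1r y) !(sqnormD_scale gP).
  rewrite rmorphN rmorph1 !mulN1r conjc1 mul1r modulus_opp Normc.normc1 raddfN /=.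
  by lra.
apply: le_trans (parallelogram _ _) _.
by rewrite -mulrA ler_wpM2l // mulrDl lerD.
Qed.

(** Here [<E u, u> = |E u|^2], so Cauchy-Schwarz reads
    [|E u|^4 <= |E u|^2 |u|^2]. *)
Lemma symmetric_idempotent_contracting E u :
  semi_adjoint E E -> (forall v, E (E v) = E v) -> sq (E u) <= sq u.
Proof.
move=> EE Eid; have := semi_cauchy_schwarz gP (E u) u.
rewrite -{1}Eid (sqnorm_adjoint _ EE) modulus_real ?(sqnorm_ge0 gP) //.
have := sqnorm_ge0 gP (E u); rewrite le_eqVlt => /predU1P[<- _|h].
  exact: sqnorm_ge0.
by rewrite expr2 ler_pM2l.
Qed.

Lemma symmetric_idempotent_bounded E :
  semi_adjoint E E -> (forall v, E (E v) = E v) -> semi_bounded E.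
Proof.
by move=> EE Eid; exists 1 => // u; rewrite mul1r symmetric_idempotent_contracting.
Qed.

(** With [P = S T] symmetric, Cauchy-Schwarz for [P^n u] and [P^(n+2) u] makes
    [|P^n u|^2] log-convex. The constant [K] may depend on [u], which is what
    continuity in a stronger norm provides, but the rate [c] may not: it
    bounds [P], and [|T u|^2 = <P u, u>] carries the bound over to [T]. *)
Lemma semi_bounded_of_geometric_growth T S (c : R) : 0 < c ->
  semi_adjoint T S ->
  (forall u, exists K, forall n, sq (iter n (S \o T) u) <= K * c ^+ n) ->
  semi_bounded T.
Proof.
move=> c0 TS growth; exists (Num.sqrt c) => [|u]; first exact: sqrtr_ge0.
have PP : semi_adjoint (S \o T) (S \o T).
  by move=> x y; rewrite /= (semi_adjoint_sym TS) TS.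
have Pu : sq (S (T u)) <= c * sq u.
  have [K uK] := growth u.
  apply: (@log_convex_ratio_bound _ (fun n => sq (iter n (S \o T) u)) _ K) => // n.
    exact: sqnorm_ge0.
  have := semi_cauchy_schwarz gP (iter n (S \o T) u) (iter n.+2 (S \o T) u).
  by rewrite [iter n.+2 _ _]iterS -PP -iterS modulus_self.
have := semi_cauchy_schwarz gP (S (T u)) u.
rewrite (sqnorm_adjoint _ TS) modulus_real ?(sqnorm_ge0 gP) // => h.
rewrite -ler_sqr ?nnegrE ?mulr_ge0 ?sqrtr_ge0 ?(sqnorm_ge0 gP) //.
rewrite exprMn sqr_sqrtr ?(ltW c0) // (le_trans h) // expr2 mulrA.
by rewrite ler_wpM2r // (sqnorm_ge0 gP).
Qed.

Lemma modulus_form_bounded T : semi_bounded T ->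
  exists K, forall u, sq u = 1 -> modulus (g (T u) u) <= K.
Proof.
move=> [c c0 Tc]; exists (Num.sqrt c) => u u1.
apply: le_trans (modulus_le_sqrt gP _ _) _.
by rewrite u1 sqrtr1 mulr1 ler_wsqrtr // (le_trans (Tc u)) // u1 mulr1.
Qed.

End BoundedOperators.

(** * The inequality at a pair of unit vectors *)

Section PointwiseInequality.
Context {R : realType} {V : lmodType R[i]} (g : V -> V -> R[i]).
Context (gP : semi_inner g).
Local Notation sq := (sqnorm g).

Lemma modulus_through_projection (E : V -> V) u v :
  semi_adjoint g E E -> E u = u -> modulus (g u v) ^+ 2 <= sq u * sq (E v).
Proof. by move=> EE Eu; rewrite -{1}Eu EE; exact: semi_cauchy_schwarz. Qed.

(** For the operators of the theorem, [E] and [F] are the projections [M Md] and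
    [N Nd] onto the ranges of [M] and [N]. The diagonal terms go through
    [modulus_through_projection], the cross term through [semi_buzano]. *)
Lemma pointwise_inequality (M N Ms Ns E F : V -> V) a b :
  semi_adjoint g M Ms -> semi_adjoint g N Ns ->
  semi_adjoint g E E -> semi_adjoint g F F ->
  (forall v, E (E v) = E v) -> (forall v, F (F v) = F v) ->
  E (M a) = M a -> F (N a) = N a -> sq b = 1 ->
  modulus (g (M a + N a) b) ^+ 2 <=
    modulus (g (Ms (M a) + 'i%C *: Ns (N a)) a)
      * modulus (g (E b + 'i%C *: F b) b)
    + 2^-1 * modulus (g (Ms (M a) + Ns (N a)) a)
    + modulus (g (Ns (M a)) a).
Proof.
move=> MMs NNs EE FF Eid Fid EM FN b1.
have selfE v : g (E v) v = ((sq (E v))%:C)%C by rewrite -(sqnorm_adjoint gP _ EE) Eid.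
have selfF v : g (F v) v = ((sq (F v))%:C)%C by rewrite -(sqnorm_adjoint gP _ FF) Fid.
rewrite !(semi_innerDl gP) !(semi_innerZl gP) selfE selfF.
rewrite (sqnorm_adjoint gP _ MMs) (sqnorm_adjoint gP _ NNs) !modulus_combination.
rewrite -(rmorphD (real_complex R)) modulus_real ?addr_ge0 ?sqnorm_ge0 //.
rewrite (semi_adjoint_sym gP NNs).
have hM := modulus_through_projection b EE EM.
have hN := modulus_through_projection b FF FN.
have sq0 v : 0 <= sq v := sqnorm_ge0 gP v.
have diag := sqr_sum_le_products (sq0 _) (sq0 _) (sq0 _) (sq0 _) hM hN.
have cross := semi_buzano gP (M a) (N a) b1.
rewrite [modulus (g b (N a))](modulus_sym gP) in cross.
have amgm : Num.sqrt (sq (M a)) * Num.sqrt (sq (N a))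
    <= 2^-1 * (sq (M a) + sq (N a)).
  rewrite -{2}(sqr_sqrtr (sq0 (M a))) -{2}(sqr_sqrtr (sq0 (N a))).
  have := sqr_ge0 (Num.sqrt (sq (M a)) - Num.sqrt (sq (N a))); nra.
have tri : modulus (g (M a) b + g (N a) b) ^+ 2
    <= (modulus (g (M a) b) + modulus (g (N a) b)) ^+ 2.
  by rewrite ler_sqr ?nnegrE ?addr_ge0 ?modulus_ge0 // modulus_add.
apply: (le_trans tri); rewrite sqrrD; lra.
Qed.

End PointwiseInequality.

(** * The seminorm of a positive operator on a Hilbert space *)

Section BerezinSupremum.
Context {R : realType} {X : Type} {H : rkhs R X}.
Implicit Types (u v : H).

Local Notation dot := (rk_dot H).

Lemma dot_semi_inner : semi_inner dot.
Proof.
split=> [a u v w|u v|u].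
- by rewrite linearPl.
- by rewrite hermC expr0 mul1r.
- have [->|/neq0_dnorm_gt0/ltW //] := eqVneq u 0; by rewrite linear0l.
Qed.

Lemma normE_sqnorm u : `|u| ^+ 2 = ((sqnorm dot u)%:C)%C.
Proof. by rewrite rk_normE sqrtCK (semi_inner_self dot_semi_inner). Qed.

Lemma continuous_sqnorm_bounded (T : {linear H -> H}) : continuous T ->
  exists2 c : R, 0 < c & forall u, sqnorm dot (T u) <= c * sqnorm dot u.
Proof.
move=> /linear_bounded_continuous /linear_boundedP /pinfty_ex_gt0 [C C0 TC].
have Creal : ((complex.Re C)%:C)%C = C by apply: RRe_real; exact: gtr0_real.
exists (complex.Re C ^+ 2) => [|u].
  by rewrite exprn_gt0 // -ltcR Creal.
rewrite -lecR rmorphM rmorphXn /= Creal -!normE_sqnorm -exprMn.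
by rewrite ler_sqr ?nnegrE ?mulr_ge0 // ltW.
Qed.

Section Seminorm.
Context (A : {linear H -> H}) (hA : positive_op A).

(** Polarization: [<A w, w>] is real for [w = u], [v], [u + v] and [u + i v]. *)
Lemma positive_op_hermitian u v : dot (A u) v = conjc (dot (A v) u).
Proof.
have real w : complex.Im (dot (A w) w) = 0 by apply: ger0_Im; apply: hA.2.
have := real (u + v); have := real (u + 'i%C *: v).
have := real u; have := real v.
have dG := dot_semi_inner.
rewrite ![A (_ + _)]linearD ![A (_ *: _)]linearZ /=.
rewrite !(semi_innerDl dG) !(semi_innerDr dG) !(semi_innerZl dG) !(semi_innerZr dG).
case: (dot (A u) u) => a a'; case: (dot (A v) v) => b b'.
case: (dot (A u) v) => x x'; case: (dot (A v) u) => y y' /=.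
move=> -> -> h1 h2; apply/eqP; rewrite eq_complex /=.
by apply/andP; split; apply/eqP; lra.
Qed.

Lemma A_dot_semi_inner : semi_inner (A_dot A).
Proof.
split=> [a u v w|u v|u].
- by rewrite /A_dot linearP linearPl.
- exact: positive_op_hermitian.
- exact: hA.2.
Qed.
Let AG := A_dot_semi_inner.

(** The equation [A Y = S A], with [S] the Hilbert adjoint of [T], says that [Y]
    is an adjoint of [T] for the semi-inner product. It covers both the
    [A]-adjoints (with [Y] the [A]-adjoint of [T]) and the [A]-selfadjoint
    operators (with [Y = T]). *)
Lemma semi_adjoint_of_adjoint (T Y S : {linear H -> H}) :
  adjoint T S -> (forall u, A (Y u) = S (A u)) -> semi_adjoint (A_dot A) T Y.
Proof.
move=> [_ TS] AY; apply: (semi_adjoint_sym AG) => u v.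
rewrite /A_dot AY (semi_innerC dot_semi_inner) -TS.
by rewrite -(semi_innerC dot_semi_inner).
Qed.

Lemma A_sqnorm_bounded : exists2 c : R, 0 <= c &
  forall u, sqnorm (A_dot A) u <= c * sqnorm dot u.
Proof.
have [c c0 Ac] := continuous_sqnorm_bounded hA.1.
exists (Num.sqrt c) => [|u]; first exact: sqrtr_ge0.
rewrite -(modulus_self AG); apply: le_trans (modulus_le_sqrt dot_semi_inner _ _) _.
have u0 := sqnorm_ge0 dot_semi_inner u.
rewrite -[leRHS]mulr1 -[X in _ <= _ * X * _](sqr_sqrtr u0) expr2 mulrA mulr1.
by rewrite ler_wpM2r ?sqrtr_ge0 // -sqrtrM ?(ltW c0) // ler_wsqrtr.
Qed.

(** Continuity alone does not give boundedness for the seminorm; the continuous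
    adjoint does. The iterates of [S T] grow geometrically in the Hilbert norm,
    which dominates the seminorm. *)
Lemma continuous_semi_bounded (T S : {linear H -> H}) :
  continuous T -> continuous S -> semi_adjoint (A_dot A) T S ->
  semi_bounded (A_dot A) T.
Proof.
move=> /continuous_sqnorm_bounded[c c0 Tc] /continuous_sqnorm_bounded[d d0 Sd] TS.
have [a a0 Aa] := A_sqnorm_bounded.
apply: (semi_bounded_of_geometric_growth AG (mulr_gt0 d0 c0) TS) => u.
exists (a * sqnorm dot u) => n.
apply: (le_trans (Aa _)); rewrite -mulrA ler_wpM2l // mulrC.
elim: n => [|n IHn]; first by rewrite expr0 mul1r.
rewrite iterS /= (le_trans (Sd _)) // exprS -!mulrA ler_pM2l //.
by rewrite (le_trans (Tc _)) // ler_pM2l.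
Qed.

(** * Berezin numbers *)

Lemma sqnorm_A_kernel k x : A_points A k x -> sqnorm (A_dot A) (A_kernel A k x) = 1.
Proof.
rewrite /A_points /A_kernel /= => nz; rewrite (sqnormZ AG) Normc.normcV exprVn.
rewrite -(modulus_self AG) -[X in _ * modulus X]sqrtCK -/(A_norm A (k x)).
rewrite [X in _ * X]Normc.normcM -expr2 mulVf // expf_eq0 /=.
by apply: contra nz => /eqP /Normc.eq0_normc ->.
Qed.

Lemma ber_upper_bound k (T : H -> H) x : semi_bounded (A_dot A) T ->
  A_points A k x ->
  modulus (A_dot A (T (A_kernel A k x)) (A_kernel A k x)) <= ber A k T.
Proof.
move=> /(modulus_form_bounded AG) [K TK] kx.
apply: ub_le_sup; last by exists x.
by exists K => _ [y ky ->]; apply/TK/sqnorm_A_kernel.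
Qed.

Lemma ber_ge0 k (T : H -> H) : 0 <= ber A k T.
Proof. by apply: nonneg_sup_ge0 => _ [x _ ->]; exact: modulus_ge0. Qed.

End Seminorm.
End BerezinSupremum.

Theorem theorem3p15 (R : realType) (X : Type) (x0 : X) (H : rkhs R X)
  (k : X -> H) (hk : reproducing_kernel k)
  (A : {linear H -> H}) (hA : positive_op A)
  (M N : {linear H -> H}) (hM : in_BA A M) (hN : in_BA A N)
  (M_closed : closed (range M)) (N_closed : closed (range N))
  (RM_comp : compatible A (range M)) (NM_comp : compatible A (null_space M))
  (RN_comp : compatible A (range N)) (NN_comp : compatible A (null_space N))
  (Ms Ns : {linear H -> H}) (hMs : A_adjoint A M Ms) (hNs : A_adjoint A N Ns)
  (Md Nd : {linear H -> H})
  (hMd : A_generalized_inverse A M Md) (hNd : A_generalized_inverse A N Nd) :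
  ber_norm A k (fun u => M u + N u) ^+ 2 <=
    ber A k (fun u => Ms (M u) + 'i%C *: Ns (N u))
      * ber A k (fun u => M (Md u) + 'i%C *: N (Nd u))
    + 2^-1 * ber A k (fun u => Ms (M u) + Ns (N u))
    + ber A k (fun u => Ns (M u)).
Proof.
have AG := A_dot_semi_inner hA.
have [Mcont _] := hM; have [Ncont _] := hN.
have [Mscont [M' M'adj AMs] _] := hMs; have [Nscont [N' N'adj ANs] _] := hNs.
have MMs := semi_adjoint_of_adjoint hA M'adj AMs.
have NNs := semi_adjoint_of_adjoint hA N'adj ANs.
have [_ MMdM _ [E' E'adj AE] _] := hMd; have [_ NNdN _ [F' F'adj AF] _] := hNd.
have EE := semi_adjoint_of_adjoint hA E'adj AE.
have FF := semi_adjoint_of_adjoint hA F'adj AF.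
have Eid v : (M \o Md) ((M \o Md) v) = (M \o Md) v by rewrite /= MMdM.
have Fid v : (N \o Nd) ((N \o Nd) v) = (N \o Nd) v by rewrite /= NNdN.
have bM := continuous_semi_bounded hA Mcont Mscont MMs.
have bN := continuous_semi_bounded hA Ncont Nscont NNs.
have bMs := continuous_semi_bounded hA Mscont Mcont (semi_adjoint_sym AG MMs).
have bNs := continuous_semi_bounded hA Nscont Ncont (semi_adjoint_sym AG NNs).
have bE := symmetric_idempotent_bounded AG EE Eid.
have bF := symmetric_idempotent_bounded AG FF Fid.
have bMsM := semi_bounded_comp bMs bM; have bNsN := semi_bounded_comp bNs bN.
set rhs := leRHS.
have rhs0 : 0 <= rhs by rewrite !addr_ge0 ?mulr_ge0 ?ber_ge0.
have pointwise x y : A_points A k x -> A_points A k y ->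
    modulus (A_dot A (M (A_kernel A k x) + N (A_kernel A k x)) (A_kernel A k y)) ^+ 2
    <= rhs.
  move=> kx ky.
  apply: le_trans (pointwise_inequality AG MMs NNs EE FF Eid Fid (MMdM _) (NNdN _)
    (sqnorm_A_kernel hA ky)) _.
  apply: lerD; first apply: lerD.
  - apply: ler_pM; rewrite ?modulus_ge0 //; apply: (ber_upper_bound hA) => //.
      exact: (semi_bounded_add AG bMsM (semi_bounded_scale AG _ bNsN)).
    exact: (semi_bounded_add AG bE (semi_bounded_scale AG _ bF)).
  - rewrite ler_wpM2l ?invr_ge0 //; apply: (ber_upper_bound hA) => //.
    exact: (semi_bounded_add AG bMsM bNsN).
  - by apply: (ber_upper_bound hA) => //; exact: semi_bounded_comp.
rewrite -[rhs]sqr_sqrtr // ler_sqr ?nnegrE ?sqrtr_ge0 //; last first.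
  by apply: nonneg_sup_ge0 => _ [x [y [_ _ ->]]]; exact: modulus_ge0.
apply: sup_le_nonneg_bound => [|_ [x [y [kx ky ->]]]]; first exact: sqrtr_ge0.
rewrite -[leLHS]ger0_norm ?modulus_ge0 // -sqrtr_sqr ler_wsqrtr //.
exact: pointwise.
Qed.
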